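(* Let $\Gamma$ be a distance-regular graph of diameter $D\geq 3$ with valency $k$ and intersection numbers $b_i,c_i$, and let $\theta_0=k>\theta_1>\cdots>\theta_D$ be its distinct eigenvalues. If $b_2+c_3\geq k+1$, then $(\theta_1+1)(\theta_{D-1}+1)(\theta_D+1)\geq -b_1(k+1-b_2-c_3)$. If $b_2+c_3\leq k+1$, then $(\theta_1+1)(\theta_{2}+1)(\theta_D+1)\leq -b_1(k+1-b_2-c_3)$. Moreover, equality holds in either case if and only if $D=3$.
   Context: For a distance-regular graph, for vertices $x,y$ at distance $i$, $c_i=|\Gamma_{i-1}(x)\cap\Gamma_1(y)|$ and $b_i=|\Gamma_{i+1}(x)\cap\Gamma_1(y)|$ depend only on $i$, where $\Gamma_j(x)$ denotes the set of vertices at distance $j$ from $x$. The eigenvalues are those of the adjacency matrix. *)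

(* Defs.v *)
From HB Require Import structures.
From mathcomp Require Import all_boot all_order all_algebra.

Set Implicit Arguments.
Unset Strict Implicit.
Unset Printing Implicit Defensive.

Import Order.TTheory GRing.Theory Num.Theory.

Definition simple_graph (T : finType) (e : rel T) : Prop :=
  symmetric e /\ irreflexive e.

Definition connected_graph (T : finType) (e : rel T) : Prop :=
  forall x y : T, connect e x y.

Definition walk (T : finType) (e : rel T) (n : nat) (x y : T) : bool :=
  [exists p : n.-tuple T, path e x p && (last x p == y)].

(* The least length of a walk from x to y. Searching the lengths below #|T|   *)
(* suffices, since a shortest walk repeats no vertex; the value is the junk   *)
(* #|T| when y is not reachable from x.                                       *)
Definition gdist (T : finType) (e : rel T) (x y : T) : nat :=
  find (fun n => walk e n x y) (iota 0 #|T|).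

Definition diameter (T : finType) (e : rel T) : nat :=
  \max_(x : T) \max_(y : T) gdist e x y.

Definition Gamma (T : finType) (e : rel T) (i : nat) (x : T) : {set T} :=
  [set y | gdist e x y == i].

(* Only the values b i and c i with i at most the diameter are constrained.   *)
(* At i = 0 the truncated i.-1 is harmless: Gamma 0 x and Gamma 1 x are       *)
(* disjoint, so c 0 = 0, as with an empty Gamma (-1) x.                       *)
Definition distance_regular (T : finType) (e : rel T) (b c : nat -> nat) : Prop :=
  [/\ simple_graph e, connected_graph e &
      forall (i : nat) (x y : T), gdist e x y = i ->
        c i = #|Gamma e i.-1 x :&: Gamma e 1 y| /\
        b i = #|Gamma e i.+1 x :&: Gamma e 1 y| ].

Definition has_valency (T : finType) (e : rel T) (k : nat) : Prop :=
  forall x : T, #|[set y | e x y]| = k.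

Local Open Scope ring_scope.

Definition adjacency_mx (R : nzRingType) (T : finType) (e : rel T) : 'M[R]_#|T| :=
  \matrix_(i, j) (e (enum_val i) (enum_val j))%:R.

Definition distinct_eigenvalues (F : realFieldType) (n : nat) (A : 'M[F]_n)
    (theta : seq F) : Prop :=
  sorted >%R theta /\ forall x : F, (x \in theta) = eigenvalue A x.

(* Main.v *)
Require Import Defs.
From mathcomp Require Import all_boot all_order all_algebra.
From mathcomp Require Import polyrcf.
From mathcomp Require Import ring lra zify.

Set Implicit Arguments.
Unset Strict Implicit.
Unset Printing Implicit Defensive.

Import Order.TTheory GRing.Theory Num.Theory.

Local Open Scope ring_scope.

(* Summing an eigenfunction of eigenvalue t <> k over the balls around a      *)
(* vertex gives a sequence with a three-term recurrence in t that starts at a *)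
(* nonzero value and ends, at radius D, with the total sum 0. Hence           *)
(* theta_1, ..., theta_D are the roots of the last member G_D of a family of  *)
(* orthogonal polynomials, the characteristic polynomials of the leading      *)
(* minors of the tridiagonal D x D matrix with diagonal k - b_i - c_{i+1} and *)
(* products b_i c_i off the diagonal. By Sturm's theorem the roots of         *)
(* consecutive G_n interlace strictly. Let x > y > z be the roots of G_3.     *)
(* Since -1 is the root of G_1, z < -1 < x, and evaluating G_3 at -1 gives    *)
(* (x + 1)(y + 1)(z + 1) = - b_1 (k + 1 - b_2 - c_3), whose sign is opposite  *)
(* to that of y + 1. If D > 3 then theta_1 > x, theta_2 > y > theta_{D-1} and *)
(* z > theta_D, so that every factor strictly grows in absolute value.        *)

(** * Interlacing roots of orthogonal polynomials *)

(** In a distance-regular graph, the number of neighbours of y inside a ball around x depends only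
    on their distance ([card_neighbors_in_ball]). For an eigenfunction this becomes the recurrence
    [ball_sum_rec], so ball sums are values of [dr_poly] up to a product of c_j
    ([ball_sum_dr_poly]). The D eigenvalues below k are distinct roots of the monic G_D of degree D,
    hence all of its roots ([nontrivial_eigenvalues_prod]). Since b_i c_i > 0 for 0 < i < D,
    consecutive G_n interlace strictly ([three_term_interlaced]). Iterating from G_3 to G_D
    ([interlaced_iter]) compares x, y, z with the extreme eigenvalues. For D = 3 they are the
    eigenvalues; for D > 3 all comparisons are strict, which settles equality. *)

Section Interlacing.
Variable R : rcfType.
Implicit Types (s t u : seq R) (p : {poly R}).

(* For strictly decreasing sequences; d = 1 is the usual strict interlacing. *)
Definition interlaced (d : nat) s t :=
  size t = (size s + d)%N /\
  forall i, (i < size s)%N -> s`_i < t`_i /\ t`_(i + d) < s`_i.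

Lemma interlaced_trans d d' s t u :
  interlaced d s t -> interlaced d' t u -> interlaced (d + d') s u.
Proof.
move=> [size_t st] [size_u tu]; split=> [|i lt_i].
  by rewrite size_u size_t addnA.
have [s_t t_s] := st i lt_i; split.
  by apply: lt_trans s_t _; case: (tu i) => //; rewrite size_t ltn_addr.
apply: lt_trans t_s; rewrite addnA.
by case: (tu (i + d)%N) => //; rewrite size_t ltn_add2r.
Qed.

Lemma interlaced1_sorted s t : interlaced 1 s t -> sorted >%R t.
Proof.
move=> [size_t st]; apply/(sortedP 0) => i; rewrite size_t addn1 ltnS => /st[].
by rewrite addn1 => lt1 lt2; apply: lt_trans lt1.
Qed.

Definition prod_roots s : {poly R} := \prod_(x <- s) ('X - x%:P).

Lemma prod_roots_sorted_inj s t :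
  sorted >%R s -> sorted >%R t -> prod_roots s = prod_roots t -> s = t.
Proof.
move=> s_sort t_sort st; apply: irr_sorted_eq s_sort t_sort _.
- exact: rev_trans lt_trans.
- exact: ltxx.
- by move=> x; rewrite -!root_prod_XsubC -/(prod_roots s) st.
Qed.

Lemma sgn_prod_roots_interlaced s t i : interlaced 1 s t -> (i < size t)%N ->
  0 < (-1) ^+ i * (prod_roots s).[t`_i].
Proof.
move=> [size_t st] lt_i.
have t_sort := interlaced1_sorted (conj size_t st).
have t_lt j l : (l < size t)%N -> (j < l)%N -> t`_l < t`_j.
  move=> lt_l lt_jl; have := sorted_ltn_nth (rev_trans lt_trans) 0 t_sort.
  by apply => //; rewrite inE (ltn_trans lt_jl).
rewrite horner_prod (big_nth 0) big_mkord.
(* One sign goes to each factor of index below i; there are i such factors because i <= [size s]. *)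
have -> : (-1) ^+ i = \prod_(j < size s) (-1) ^+ (j < i)%N :> R.
  have sum_lt m : (\sum_(j < m) (j < i)%N = minn i m)%N.
    by elim: m => [|m IHm]; rewrite ?big_ord0 ?minn0 // big_ord_recr /= IHm; lia.
  by rewrite prodrXr sum_lt; congr (_ ^+ _); lia.
rewrite -big_split /=; apply: prodr_gt0 => j _; rewrite hornerXsubC.
have [s_t t_s] := st j (ltn_ord j).
have [lt_ji|le_ij] := ltnP j i.
  rewrite expr1 mulN1r opprB subr_gt0; move: lt_ji; rewrite leq_eqVlt.
  case/predU1P => [<-|/(t_lt _ _ lt_i) lt_ti]; first by rewrite -addn1.
  by apply: lt_trans lt_ti _; rewrite -addn1.
rewrite expr0 mul1r subr_gt0; move: le_ij; rewrite leq_eqVlt.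
case/predU1P => [->|] //; move/(t_lt _ _ _) => lt_ti.
by apply: lt_trans s_t (lt_ti _); rewrite size_t addn1 ltnS ltnW.
Qed.

Lemma size_prod_roots s : size (prod_roots s) = (size s).+1.
Proof. exact: size_prod_XsubC. Qed.

Lemma uniq_roots_prod_roots p s : p \is monic -> size p = (size s).+1 ->
  uniq s -> all (root p) s -> p = prod_roots s.
Proof.
move=> /monicP p_mon size_p s_uniq s_roots.
by rewrite [LHS](all_roots_prod_XsubC size_p s_roots) ?uniq_rootsE // p_mon scale1r.
Qed.

Lemma monic_pos_right p (y : R) : p \is monic -> exists2 x, y < x & 0 < p.[x].
Proof.
move=> /monicP p_mon; have [|n le_n] := @poly_pinfty_gt_lc _ p; first by rewrite p_mon.
exists (Num.max n (y + 1)); first by rewrite lt_max ltrDl ltr01 orbT.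
by apply: lt_le_trans (le_n _ _); rewrite ?p_mon ?ltr01 // le_max lexx.
Qed.

Lemma monic_sgn_left p (y : R) : (0 < size p)%N -> p \is monic ->
  exists2 x, x < y & 0 < (-1) ^+ (size p).-1 * p.[x].
Proof.
move=> p_gt0 p_mon; pose q := (-1) ^+ (size p).-1 *: (p \Po (- 'X)).
have q_mon : q \is monic.
  rewrite monicE lead_coefZ lead_coef_comp ?size_polyN ?size_polyX //.
  by rewrite lead_coefN lead_coefX (monicP p_mon) mul1r -expr2 sqrr_sign.
have [x lt_yx] := monic_pos_right (- y) q_mon.
rewrite hornerZ horner_comp hornerN hornerX => px; exists (- x) => //.
by rewrite ltrNl.
Qed.

(** Adding a point to the right of [t] and one to its left gives [size t + 2] points at which p
    alternates in sign. The intermediate value theorem yields a root in each gap, and by degree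
    there are no others. *)
Lemma interlaced_of_sign_changes p t : p \is monic -> size p = (size t).+2 ->
    sorted >%R t ->
    (forall i, (i < size t)%N -> (-1) ^+ i * p.[t`_i] < 0) ->
  exists2 u, p = prod_roots u & interlaced 1 t u.
Proof.
move=> p_mon size_p t_sort p_sgn.
have [z lt_tz pz] := monic_pos_right t`_0 p_mon.
have p_gt0 : (0 < size p)%N by rewrite size_p.
have [w] := monic_sgn_left (Num.min z (last z t)) p_gt0 p_mon.
rewrite lt_min => /andP[lt_wz lt_wt] pw.
pose x := z :: rcons t w.
have x_sgn i : (i < (size t).+2)%N -> 0 < (-1) ^+ i * p.[x`_i].
  case: i => [|i] lt_i; first by rewrite expr0 mul1r.
  rewrite /x /= nth_rcons exprS -mulrA mulN1r oppr_gt0.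
  have [lt_it|le_ti] := ltnP i (size t); first exact: p_sgn.
  have -> : i = size t by apply/eqP; rewrite eqn_leq le_ti -ltnS -ltnS lt_i.
  rewrite eqxx.
  by rewrite -oppr_gt0 -mulNr -mulN1r -exprS; move: pw; rewrite size_p.
have x_dec i : (i < (size t).+1)%N -> x`_i.+1 < x`_i.
  move=> lt_i; have : sorted >%R x.
    rewrite /x /= rcons_path /= lt_wt andbT.
    by case: (t) t_sort lt_tz => //= a t' -> ->.
  by move/(sortedP 0); apply; rewrite /= size_rcons.
(* The range of i is a premise inside a boolean predicate, so that [xchoose] selects a root for
   every index. *)
have roots_ex i : exists a : R,
    (i < (size t).+1)%N ==> (x`_i.+1 < a < x`_i) && root p a.
  have [lt_i|_] := ltnP i (size t).+1; last by exists 0.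
  have le_x := ltW (x_dec i lt_i).
  have [|a a_in pa] := poly_ivtoo (p := p) le_x.
    have := x_sgn i.+1 lt_i; have := x_sgn i (ltnW lt_i).
    rewrite [(-1) ^+ i.+1]exprS -[(-1) ^+ i]signr_odd.
    by case: odd; rewrite ?expr0 ?expr1; nra.
  by exists a; move: a_in; rewrite in_itv /= => ->.
have [f fP] : exists f : nat -> R, forall i, (i < (size t).+1)%N ->
    x`_i.+1 < f i < x`_i /\ root p (f i).
  exists (fun i => xchoose (roots_ex i)) => i lt_i; apply/andP.
  exact: (implyP (xchooseP (roots_ex i))).
pose u := mkseq f (size t).+1.
have size_u : size u = (size t).+1 by rewrite size_mkseq.
have tu : interlaced 1 t u.
  split=> [|i lt_i]; first by rewrite size_u addn1.
  rewrite !nth_mkseq ?addn1 // 1?ltnW //.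
  have [/andP[_ lt1] _] := fP i.+1 lt_i; have [/andP[lt2 _] _] := fP i (ltnW lt_i).
  by move: lt1 lt2; rewrite /x /= nth_rcons lt_i.
exists u => //; apply: uniq_roots_prod_roots => //.
- by rewrite size_u.
- by apply: sorted_uniq (interlaced1_sorted tu);
    [exact: rev_trans lt_trans | exact: ltxx].
- by apply/allP => _ /mapP[i i_in ->]; move: i_in; rewrite mem_iota => /andP[_ /fP[]].
Qed.

(** * Three-term recurrences and Sturm interlacing *)

Fixpoint three_term (a w : nat -> R) n : {poly R} :=
  if n is m.+1 then
    ('X - (a m)%:P) * three_term a w m
      - (if m is l.+1 then w m *: three_term a w l else 0)
  else 1.

Lemma three_termSS a w n : three_term a w n.+2 =
  ('X - (a n.+1)%:P) * three_term a w n.+1 - w n.+1 *: three_term a w n.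
Proof. by []. Qed.

Lemma three_term_monic a w n :
  three_term a w n \is monic /\ size (three_term a w n) = n.+1.
Proof.
have [//] : (three_term a w n \is monic /\ size (three_term a w n) = n.+1) /\
   (three_term a w n.+1 \is monic /\ size (three_term a w n.+1) = n.+2).
elim: n => [|n [[mon1 size1] [mon2 size2]]].
  by rewrite /= mulr1 subr0 monicXsubC size_XsubC monic1 size_poly1.
split=> //; rewrite [three_term a w n.+2]/=.
set q := three_term a w n.+1; rewrite -/q in mon2 size2 *.
have q_neq0 : q != 0 by rewrite -size_poly_gt0 size2.
have size_lead : size (('X - (a n.+1)%:P) * q) = n.+3.
  by rewrite size_monicM ?monicXsubC // size_XsubC size2.
have lt_size : (size (- (w n.+1 *: three_term a w n)) < n.+3)%N.
  by rewrite size_polyN (leq_ltn_trans (size_scale_leq _ _)) // size1.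
rewrite size_polyDl ?size_lead // monicE lead_coefDl ?size_lead //.
by rewrite -monicE monicMl ?monicXsubC.
Qed.

(** At a root of p_M the recurrence reads p_(M+1) = - w_M p_(M-1). By induction the roots of p_M
    interlace those of p_(M-1), so these values alternate in sign as [interlaced_of_sign_changes]
    requires. *)
Lemma three_term_interlaced a w N : (forall n, (0 < n < N)%N -> 0 < w n) ->
  exists r : nat -> seq R,
    (forall n, (n <= N)%N -> three_term a w n = prod_roots (r n)) /\
    (forall n, (n < N)%N -> interlaced 1 (r n) (r n.+1)).
Proof.
move=> w_gt0; suff : forall M, (M <= N)%N -> exists r : nat -> seq R,
    (forall n, (n <= M)%N -> three_term a w n = prod_roots (r n)) /\
    (forall n, (n < M)%N -> interlaced 1 (r n) (r n.+1)) by apply.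
elim=> [_|M IHM lt_M].
  exists (fun => [::]); split=> // n; rewrite leqn0 => /eqP ->.
  by rewrite /prod_roots big_nil.
have [r [r_prod r_inter]] := IHM (ltnW lt_M).
have size_r n : (n <= M)%N -> size (r n) = n.
  move/r_prod => rn; have [_] := three_term_monic a w n.
  by rewrite rn size_prod_roots => -[].
have [mon size_M1] := three_term_monic a w M.+1.
have [||i lt_i|u u_prod u_inter] := interlaced_of_sign_changes (t := r M) mon.
- by rewrite size_r.
- case: M r_inter size_r {IHM lt_M r_prod mon size_M1} => [_ s0|M r_inter _].
    by have /size0nil -> := s0 0%N (leqnn _).
  exact: interlaced1_sorted (r_inter M (leqnn _)).
- have root_i : root (three_term a w M) (r M)`_i.
    by rewrite r_prod // root_prod_XsubC mem_nth.
  rewrite /= hornerD hornerM (rootP root_i) mulr0 add0r.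
  have lt_iM : (i < M)%N by rewrite -[M]size_r.
  case: {IHM size_r mon size_M1 root_i} M lt_M r_prod r_inter lt_i lt_iM => // l.
  move=> lt_l r_prod r_inter lt_i _.
  have := sgn_prod_roots_interlaced (r_inter l (leqnn _)) lt_i.
  rewrite -r_prod // hornerN hornerZ mulrN oppr_lt0 mulrCA; apply: mulr_gt0.
  by rewrite w_gt0.
exists (fun n => if n == M.+1 then u else r n); split=> n le_n.
  by case: eqP => [-> //|/eqP ne_n]; apply: r_prod; rewrite -ltnS ltn_neqAle ne_n.
rewrite (ltn_eqF le_n) eqSS; case: eqP => [-> //|/eqP ne_n].
by apply: r_inter; rewrite ltn_neqAle ne_n -ltnS.
Qed.

Lemma interlaced_iter (r : nat -> seq R) N m n :
    (forall i, (i < N)%N -> interlaced 1 (r i) (r i.+1)) ->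
    (m + n.+1 <= N)%N ->
  interlaced n.+1 (r m) (r (m + n.+1)%N).
Proof.
move=> r_inter; elim: n => [|n IHn] le_N.
  by rewrite addn1; apply: r_inter; rewrite -addn1.
rewrite -[n.+2]addn1 addnA; apply: interlaced_trans (IHn _) _.
  by apply: leq_trans le_N; rewrite leq_add2l.
by rewrite [in r (_ + 1)%N]addn1; apply: r_inter; rewrite -addnS.
Qed.

End Interlacing.

(** * Distances and balls in a distance-regular graph *)

Section Distance.
Variables (T : finType) (e : rel T).
Implicit Types x y z : T.

Lemma walkP n x y :
  reflect (exists p, [/\ size p = n, path e x p & last x p = y]) (walk e n x y).
Proof.
apply: (iffP existsP) => [[p /andP[ep /eqP lp]]|[p [sp ep lp]]].
  by exists p; rewrite size_tuple.
have sp' : size p == n by rewrite sp.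
by exists (Tuple sp'); rewrite /= ep lp eqxx.
Qed.

Lemma gdist_le_walk n x y : walk e n x y -> (gdist e x y <= n)%N.
Proof.
move=> w; rewrite leqNgt; apply/negP => lt_n.
have n_lt : (n < #|T|)%N.
  by apply: leq_trans lt_n _; rewrite -[X in (_ <= X)%N](size_iota 0) find_size.
by have := before_find 0%N lt_n; rewrite nth_iota // add0n w.
Qed.

Lemma gdist_eq0 x y : (gdist e x y == 0%N) = (x == y).
Proof.
apply/idP/eqP => [|<-].
  rewrite /gdist; have : (0 < #|T|)%N by apply/card_gt0P; exists x.
  case: #|T| => //= m _; case: ifP => // /walkP[p [/size0nil -> _ /= ->]] //.
by rewrite -leqn0; apply: gdist_le_walk; apply/walkP; exists [::].
Qed.

Hypothesis e_conn : connected_graph e.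

(** A path without repeated vertices has length below [#|T|], so the search defining [gdist]
    succeeds. *)
Lemma walk_gdist x y : walk e (gdist e x y) x y.
Proof.
have /connectP[p0 ep0 ->] := e_conn x y; case: (shortenP ep0) => p ep up _.
set z := last x p.
have wp : walk e (size p) x z by apply/walkP; exists p.
have sp : (size p < #|T|)%N by rewrite -[(size p).+1](card_uniqP up) max_card.
have hasw : has (fun n => walk e n x z) (iota 0 #|T|).
  by apply/hasP; exists (size p) => //; rewrite mem_iota.
have := nth_find 0%N hasw; rewrite nth_iota // -[X in (_ < X)%N](size_iota 0).
by rewrite -has_find.
Qed.

Lemma gdist_leS x y z : e y z -> (gdist e x z <= (gdist e x y).+1)%N.
Proof.
move=> eyz; have /walkP[p [sp ep lp]] := walk_gdist x y.
apply: gdist_le_walk; apply/walkP; exists (rcons p z).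
by rewrite size_rcons sp rcons_path ep lp last_rcons.
Qed.

Lemma gdist_pred n x y :
  gdist e x y = n.+1 -> exists2 z, gdist e x z = n & e z y.
Proof.
move=> dxy; have := walk_gdist x y; rewrite dxy => /walkP[p [sp ep lp]].
case/lastP: p sp ep lp => // p w.
rewrite size_rcons rcons_path last_rcons => -[sp] /andP[ep ew] wy.
rewrite wy in ew; exists (last x p) => //; apply/eqP; rewrite eqn_leq.
rewrite gdist_le_walk -1?ltnS -1?dxy ?gdist_leS //.
by apply/walkP; exists p.
Qed.

Lemma gdist_eq1 x y : irreflexive e -> (gdist e x y == 1%N) = e x y.
Proof.
move=> e_irr; apply/eqP/idP => [/gdist_pred[z /eqP]|exy].
  by rewrite gdist_eq0 => /eqP <-.
apply/eqP; rewrite eqn_leq lt0n gdist_eq0.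
rewrite (_ : x != y) ?andbT; last by apply: contraTneq exy => ->; rewrite e_irr.
by apply: gdist_le_walk; apply/walkP; exists [:: y]; rewrite /= exy.
Qed.

Lemma gdist_realized n :
  T -> (n <= diameter e)%N -> exists x, exists y, gdist e x y = n.
Proof.
move=> x0; have T_gt0 : (0 < #|T|)%N by apply/card_gt0P; exists x0.
have [x dx] := @bigop.eq_bigmax T (fun x : T => \max_(y : T) gdist e x y)%N T_gt0.
have [y dy] := @bigop.eq_bigmax T (gdist e x) T_gt0.
rewrite /diameter dx dy => /subnKC; move: (_ - _)%N => m.
elim: m y {dy} => [|m IHm] y; first by rewrite addn0 => dxy; exists x, y.
by rewrite addnS => /esym/gdist_pred[z /esym dz _]; apply: IHm dz.
Qed.

Lemma gdist_le_diameter x y : (gdist e x y <= diameter e)%N.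
Proof.
apply: (@leq_trans (\max_y gdist e x y)%N); first exact: leq_bigmax.
exact: (@bigop.leq_bigmax T (fun x => \max_y gdist e x y)%N).
Qed.

End Distance.

(** * Ball sums of an eigenfunction *)

Section DistanceRegular.
Variables (T : finType) (e : rel T) (b c : nat -> nat) (k : nat).
Hypotheses (e_dr : distance_regular e b c) (e_val : has_valency e k).

Let e_sym : symmetric e. Proof. by case: e_dr => -[]. Qed.
Let e_irr : irreflexive e. Proof. by case: e_dr => -[]. Qed.
Let e_conn : connected_graph e. Proof. by case: e_dr. Qed.

Lemma card_sphere_pred i x y : gdist e x y = i.+1 ->
  #|[set z | e y z && (gdist e x z == i)]| = c i.+1.
Proof.
case: e_dr => _ _ H /H[-> _]; apply: eq_card => z.
by rewrite !inE gdist_eq1 // andbC.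
Qed.

Lemma card_sphere_succ i x y : gdist e x y = i ->
  #|[set z | e y z && (gdist e x z == i.+1)]| = b i.
Proof.
case: e_dr => _ _ H /H[_ ->]; apply: eq_card => z.
by rewrite !inE gdist_eq1 // andbC.
Qed.

Lemma dr_b0 (x : T) : b 0 = k.
Proof.
have /eqP d0 : gdist e x x == 0%N by rewrite gdist_eq0.
rewrite -(card_sphere_succ d0) -(e_val x); apply: eq_card => z.
by rewrite !inE gdist_eq1 // andbb.
Qed.

Lemma dr_c1 (x : T) : (0 < diameter e)%N -> c 1 = 1%N.
Proof.
move=> /(gdist_realized e_conn x)[{}x [y dxy]].
rewrite -(card_sphere_pred dxy) -(cards1 x); apply: eq_card => z.
rewrite !inE gdist_eq0 [x == z]eq_sym andbC; case: eqVneq => //= ->.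
by rewrite e_sym -gdist_eq1 // dxy.
Qed.

Lemma dr_b_gt0 (x : T) i : (i < diameter e)%N -> (0 < b i)%N.
Proof.
move=> /(gdist_realized e_conn x)[{}x [y dxy]].
have [z dxz ezy] := gdist_pred e_conn dxy.
by rewrite -(card_sphere_succ dxz); apply/card_gt0P; exists y; rewrite inE ezy dxy eqxx.
Qed.

Lemma dr_c_gt0 (x : T) i : (i < diameter e)%N -> (0 < c i.+1)%N.
Proof.
move=> /(gdist_realized e_conn x)[{}x [y dxy]].
have [z dxz ezy] := gdist_pred e_conn dxy.
rewrite -(card_sphere_pred dxy); apply/card_gt0P; exists z.
by rewrite inE e_sym ezy dxz eqxx.
Qed.

Variable R : rcfType.

(** The count is k, k - b_i, c_(i+1) or 0 according as the distance is below i, equal to i, equal to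
    i + 1, or larger. Writing it with indicators of balls makes it sum directly to ball sums. *)
Lemma card_neighbors_in_ball i x y :
  #|[set z | e y z && (gdist e x z < i.+1)%N]|%:R =
  (k%:R - (b i)%:R - (c i.+1)%:R) * (gdist e x y < i.+1)%:R
   + (b i)%:R * (gdist e x y < i)%:R + (c i.+1)%:R * (gdist e x y < i.+2)%:R :> R.
Proof.
have lip z : e y z -> (gdist e x z <= (gdist e x y).+1)%N by exact: gdist_leS.
have lip' z : e y z -> (gdist e x y <= (gdist e x z).+1)%N.
  by rewrite e_sym; exact: gdist_leS.
case: (ssrnat.ltngtP (gdist e x y) i) => [lt_i|gt_i|dxy].
- have -> : (gdist e x y < i.+2)%N by rewrite ltnS ltnW // ltnS ltnW.
  rewrite (_ : [set z | _] = [set z | e y z]) ?e_val ?ltnS ?(ltnW lt_i) ?mulr1 ?mulr1.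
    by rewrite [X in X + _]addrAC !subrK.
  apply/setP => z; rewrite !inE; case: (boolP (e y z)) => //= /lip d.
  by rewrite ltnS (leq_trans d).
- rewrite ltnS leqNgt gt_i !mulr0 !add0r ltnS.
  have := gt_i; case: (ssrnat.ltngtP (gdist e x y) i.+1) => // [gt_i1 _|dxy _].
    rewrite mulr0 (_ : [set z | _] = set0) ?cards0 //; apply/setP => z; rewrite !inE.
    case: (boolP (e y z)) => //= /lip' d; rewrite ltnS leqNgt.
    by rewrite -ltnS (leq_trans gt_i1 d).
  rewrite mulr1 -(card_sphere_pred dxy); congr (_%:R); apply: eq_card => z.
  rewrite !inE; case: (boolP (e y z)) => //= /lip'.
  by rewrite dxy !ltnS eqn_leq => ->; rewrite andbT.
- rewrite dxy !ltnS leqnn leqnSn ?ltnn mulr0 addr0 !mulr1 subrK.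
  rewrite -(e_val y) -(card_sphere_succ dxy).
  rewrite (_ : [set z | e y z] = [set z | e y z && (gdist e x z < i.+1)%N]
     :|: [set z | e y z && (gdist e x z == i.+1)]).
    rewrite cardsU (_ : _ :&: _ = set0) ?cards0 ?subn0 ?natrD ?addrK //.
    apply/setP => z; rewrite !inE; case: (e y z) => //=.
    by rewrite ltn_neqAle -andbA; case: eqP; rewrite ?andbF.
  apply/setP => z; rewrite !inE -andb_orr; case: (boolP (e y z)) => //= /lip.
  by rewrite dxy ltnS orbC -leq_eqVlt => ->.
Qed.

Variables (f : T -> R) (t : R).
Hypothesis f_eig : forall y, \sum_z (e y z)%:R * f z = t * f y.

(** The strict inequality shifts the index: [ball_sum x i.+1] has radius i, and index 0 is the empty
    ball, which starts the recurrence at 0. *)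
Let ball_sum x i := \sum_y (gdist e x y < i)%:R * f y.

Lemma ball_sum_rec x i : t * ball_sum x i.+1 =
  (k%:R - (b i)%:R - (c i.+1)%:R) * ball_sum x i.+1
   + (b i)%:R * ball_sum x i + (c i.+1)%:R * ball_sum x i.+2.
Proof.
rewrite !mulr_sumr -!big_split /=.
transitivity (\sum_y \sum_z (gdist e x y < i.+1)%:R * ((e y z)%:R * f z)).
  by apply: eq_bigr => y _; rewrite -mulr_sumr f_eig mulrCA.
rewrite exchange_big; apply: eq_bigr => z _.
rewrite !mulrA -!mulrDl -card_neighbors_in_ball -sum1_card natr_sum mulr_suml.
rewrite [RHS]big_mkcond; apply: eq_bigr => y _.
rewrite inE mulrA -natrM mulnb andbC e_sym.
by case: ifP; rewrite ?mul0r.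
Qed.

Definition dr_poly : nat -> {poly R} :=
  three_term (fun i => k%:R - (b i)%:R - (c i.+1)%:R) (fun i => (b i * c i)%:R).

(** Multiplying the recurrence by c_1 ... c_i absorbs the coefficient c_(i+1) of the new term and
    turns b_i into b_i c_i, which is the monic recurrence of [dr_poly]. *)
Lemma ball_sum_dr_poly x i :
  (\prod_(j < i) c j.+1)%:R * ball_sum x i.+1 = (dr_poly i).[t] * f x.
Proof.
have ball_sum0 : ball_sum x 0 = 0.
  by rewrite /ball_sum big1 // => y _; rewrite ltn0 mul0r.
have ball_sum1 : ball_sum x 1 = f x.
  rewrite /ball_sum (bigD1 x) //= ltnS leqn0 gdist_eq0 eqxx mul1r big1 ?addr0 //.
  by move=> y ne_yx; rewrite ltnS leqn0 gdist_eq0 eq_sym (negPf ne_yx) mul0r.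
have step j : (c j.+1)%:R * ball_sum x j.+2 =
    (t - (k%:R - (b j)%:R - (c j.+1)%:R)) * ball_sum x j.+1 - (b j)%:R * ball_sum x j.
  by rewrite mulrBl ball_sum_rec; ring.
suff [//] : (\prod_(j < i) c j.+1)%:R * ball_sum x i.+1 = (dr_poly i).[t] * f x /\
    (\prod_(j < i.+1) c j.+1)%:R * ball_sum x i.+2 = (dr_poly i.+1).[t] * f x.
elim: i => [|i [IH1 IH2]].
  rewrite big_ord1 big_ord0 /dr_poly /= mulr1 subr0 hornerXsubC hornerC !mul1r.
  by rewrite step ball_sum0 ball_sum1 mulr0 subr0.
split=> //; rewrite big_ord_recr /= natrM -mulrA step.
rewrite /dr_poly three_termSS -/(dr_poly i.+1) -/(dr_poly i).
rewrite hornerD hornerN hornerM hornerXsubC hornerZ natrM.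
rewrite !mulrBl -!mulrA -IH1 -IH2 big_ord_recr /= natrM; ring.
Qed.

Lemma root_dr_poly : t != k%:R -> (exists x, f x != 0) -> root (dr_poly (diameter e)) t.
Proof.
move=> t_neq_k [x fx_neq0].
have ball_sumT : ball_sum x (diameter e).+1 = \sum_y f y.
  by apply: eq_bigr => y _; rewrite ltnS gdist_le_diameter mul1r.
have sum0 : \sum_y f y = 0.
  (* Summed over all y, the eigenvalue equation counts each [f z] once per neighbour, that is k
     times. *)
  have : (t - k%:R) * \sum_y f y = 0.
    rewrite mulrBl [t * _]mulr_sumr -(eq_bigr _ (fun y _ => f_eig y)) exchange_big /=.
    apply/eqP; rewrite subr_eq0 mulr_sumr; apply/eqP; apply: eq_bigr => z _.
    rewrite -mulr_suml -natr_sum; congr (_%:R * _).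
    rewrite -(e_val z) -sum1_card [RHS]big_mkcond; apply: eq_bigr => y _.
    by rewrite inE e_sym; case: (e z y).
  by move/eqP; rewrite mulf_eq0 subr_eq0 (negPf t_neq_k) => /eqP.
apply/rootP; apply: (mulIf fx_neq0).
by rewrite -ball_sum_dr_poly ball_sumT sum0 mulr0 mul0r.
Qed.

End DistanceRegular.

(** * Eigenvalues as roots of [dr_poly] *)

Lemma eigenvalue_adjacency (R : realFieldType) (T : finType) (e : rel T) (t : R) :
  symmetric e -> eigenvalue (adjacency_mx R e) t ->
  exists2 f : T -> R, (exists x, f x != 0) &
    forall y, \sum_z (e y z)%:R * f z = t * f y.
Proof.
move=> e_sym /eigenvalueP[v vA v_neq0]; exists (fun x => v 0 (enum_rank x)).
  have /rV0Pn[i vi] := v_neq0.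
  by exists (enum_val i); rewrite enum_valK.
move=> y; have := congr1 (fun u : 'rV_ _ => u 0 (enum_rank y)) vA.
rewrite !mxE => <-; rewrite (reindex_onto (@enum_val T T) enum_rank) /=; last first.
  by move=> x _; rewrite enum_rankK.
apply: eq_big => [i|i _]; first by rewrite enum_valK eqxx.
by rewrite !mxE enum_valK enum_rankK mulrC e_sym.
Qed.

Lemma nontrivial_eigenvalues_prod (R : rcfType) (T : finType) (e : rel T) (k : nat)
    (b c : nat -> nat) (t : seq R) :
    distance_regular e b c -> has_valency e k ->
    distinct_eigenvalues (adjacency_mx R e) (k%:R :: t) ->
    size t = diameter e ->
  dr_poly b c k R (diameter e) = prod_roots t.
Proof.
move=> e_dr e_val [kt_sort kt_eig] size_t; have [[e_sym _] _ _] := e_dr.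
have gt_trans : transitive (>%R : rel R) by exact: rev_trans lt_trans.
have [G_mon size_G] : dr_poly b c k R (diameter e) \is monic /\ _ :=
  three_term_monic _ _ _.
apply: uniq_roots_prod_roots => //; first by rewrite size_G size_t.
  by apply: sorted_uniq (path_sorted kt_sort) => // x; rewrite /= ltxx.
apply/allP => x x_t; have : x \in k%:R :: t by rewrite inE x_t orbT.
rewrite kt_eig => /(eigenvalue_adjacency e_sym)[f f_neq0 f_eig].
apply: (root_dr_poly e_dr e_val f_eig) => //.
have /allP/(_ x x_t) := order_path_min gt_trans kt_sort.
by move=> /= lt_xk; rewrite lt_eqF.
Qed.

Lemma size3_seqE (A : Type) (x0 : A) (s : seq A) : size s = 3 ->
  s = [:: nth x0 s 0; nth x0 s 1; nth x0 s 2].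
Proof. by case: s => [|x [|y [|z []]]]. Qed.

Theorem theorem3p2 (R : rcfType) (T : finType) (e : rel T) (D k : nat)
    (b c : nat -> nat) (theta : seq R)
    (e_dr : distance_regular e b c)
    (e_diam : diameter e = D) (D_ge3 : (3 <= D)%N)
    (e_val : has_valency e k)
    (theta_eig : distinct_eigenvalues (adjacency_mx R e) theta)
    (theta_size : size theta = D.+1)
    (theta_0 : theta`_0 = k%:R) :
  ((k + 1 <= b 2 + c 3)%N ->
     let lhs := (theta`_1 + 1) * (theta`_(D - 1) + 1) * (theta`_D + 1) in
     let rhs := - (b 1%N)%:R * (k%:R + 1 - (b 2%N)%:R - (c 3%N)%:R) in
     lhs >= rhs /\ (lhs = rhs <-> D = 3%N))
  /\
  ((b 2 + c 3 <= k + 1)%N ->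
     let lhs := (theta`_1 + 1) * (theta`_2 + 1) * (theta`_D + 1) in
     let rhs := - (b 1%N)%:R * (k%:R + 1 - (b 2%N)%:R - (c 3%N)%:R) in
     lhs <= rhs /\ (lhs = rhs <-> D = 3%N)).
Proof.
case: theta theta_eig theta_size theta_0 => // k' t theta_eig [size_t] /= k'E.
rewrite {k'}k'E in theta_eig *; subst D.
have [[e_sym _] _ _] := e_dr.
(* An eigenvector is nonzero, so the graph has a vertex. *)
have [x0 _] : exists x0 : T, true.
  have : eigenvalue (adjacency_mx R e) k%:R by rewrite -(theta_eig.2) mem_head.
  by case/(eigenvalue_adjacency e_sym) => f [x _] _; exists x.
have prod_t := nontrivial_eigenvalues_prod e_dr e_val theta_eig size_t.
move: prod_t D_ge3 (dr_b_gt0 e_dr x0) (dr_c_gt0 e_dr x0).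
have b0k := dr_b0 e_dr e_val x0.
rewrite -size_t; set D := size t => prod_t D_ge3 b_gt0 c_gt0.
have D_gt0 : (0 < D)%N by exact: ltn_trans D_ge3.
have c1 : c 1 = 1%N by apply: (dr_c1 e_dr x0); rewrite -size_t.
pose G := dr_poly b c k R.
have w_gt0 n : (0 < n < D)%N -> 0 < (b n * c n)%:R :> R.
  case: n => // n /= lt_n; rewrite ltr0n muln_gt0 b_gt0 ?c_gt0 //; exact: ltnW.
have [r [r_prod r_inter]] := three_term_interlaced
  (fun i => k%:R - (b i)%:R - (c i.+1)%:R) w_gt0.
have {}r_prod n : (n <= D)%N -> G n = prod_roots (r n) by exact: r_prod.
have size_r n : (n <= D)%N -> size (r n) = n.
  move=> /r_prod rn; have : size (G n) = n.+1 by case: (three_term_monic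
    (fun i => k%:R - (b i)%:R - (c i.+1)%:R : R) (fun i => (b i * c i)%:R) n).
  by rewrite rn size_prod_roots => -[].
have t_r : t = r D.
  apply: prod_roots_sorted_inj; last by rewrite -r_prod // -prod_t.
    exact: path_sorted (theta_eig.1).
  rewrite -(ltn_predK D_ge3); apply/interlaced1_sorted/r_inter.
  by rewrite (ltn_predK D_ge3).
have r1 : (r 1)`_0 = -1.
  have size1 := size_r 1%N D_gt0.
  have : root (G 1) (-1).
    by apply/rootP; rewrite /G /dr_poly /= mulr1 subr0 hornerXsubC b0k c1; ring.
  rewrite r_prod ?root_prod_XsubC //.
  by case: (r 1) size1 => [|x []] //= _; rewrite inE => /eqP.
(* From [r 1] to [r 3] the gap is 2, which places -1 strictly between the last and the first root of
   G_3. *)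
have [_ /(_ 0%N)] := interlaced_iter (m := 1) (n := 1) r_inter D_ge3.
rewrite size_r ?r1 // => /(_ isT)[x_gt z_lt].
have := size3_seqE 0 (size_r 3 D_ge3).
set x := _`_0 in x_gt *; set y := _`_1; set z := _`_2 in z_lt *.
move=> r3; set rhs := _ * (_ - _).
have rhsE : rhs = (x + 1) * (y + 1) * (z + 1).
  have GE : (G 3).[-1] = - rhs.
    rewrite /G /dr_poly !three_termSS /= mulr1 subr0.
    rewrite !(hornerD, hornerN, hornerM, hornerZ, hornerX, hornerC) b0k c1 !natrM /rhs.
    ring.
  rewrite -[LHS]opprK -GE r_prod // r3 /prod_roots !big_cons big_nil mulr1.
  by rewrite !hornerM !hornerXsubC; ring.
have x1_gt0 : 0 < x + 1 by rewrite -(opprK 1) subr_gt0.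
have z1_lt0 : z + 1 < 0 by rewrite -(opprK 1) subr_lt0.
(* As x + 1 > 0 > z + 1 and - b_1 < 0, the sign of y + 1 is read off from the two expressions of
   [rhs]. *)
have rhs_sgn : ((k + 1 <= b 2 + c 3)%N -> y + 1 <= 0) /\
    ((b 2 + c 3 <= k + 1)%N -> 0 <= y + 1).
  have b1_lt0 : - (b 1)%:R < 0 :> R.
    by rewrite oppr_lt0 ltr0n b_gt0 // (ltn_trans _ D_ge3).
  split=> le_k.
    rewrite -(pmulr_rle0 _ x1_gt0) -(nmulr_lge0 _ z1_lt0) -rhsE nmulr_rge0 //.
    by rewrite -addrA -opprD subr_le0 -[1]/(1%:R) -!natrD ler_nat.
  rewrite -(pmulr_rge0 _ x1_gt0) -(nmulr_lle0 _ z1_lt0) -rhsE nmulr_rle0 //.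
  by rewrite -addrA -opprD subr_ge0 -[1]/(1%:R) -!natrD ler_nat.
have [D3|D_neq3] := eqVneq D 3%N.
  have -> : t = [:: x; y; z] by rewrite t_r D3.
  by rewrite D3 /= rhsE; split=> _.
have D_gt3 : (3 < D)%N by rewrite ltn_neqAle eq_sym D_neq3.
(* The gap is D - 3, written as a successor because D > 3. *)
have := interlaced_iter (m := 3) (n := D - 4) r_inter.
rewrite (_ : (3 + (D - 4).+1)%N = D); last by lia.
move=> /(_ (leqnn _))[_]; rewrite (size_r _ D_ge3) -t_r => lt_r.
have [x_lt _] := lt_r 0%N isT; have [y_lt y_gt] := lt_r 1%N isT.
have [_ z_gt] := lt_r 2%N isT.
have kt1 : (k%:R :: t)`_(D - 1) = t`_(1 + (D - 4).+1).
  by rewrite (_ : (D - 1)%N = (1 + (D - 4).+1).+1); last lia.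
have kt2 : (k%:R :: t)`_D = t`_(2 + (D - 4).+1).
  by rewrite {1}(_ : D = (2 + (D - 4).+1).+1); last lia.
rewrite kt1 kt2 rhsE; case: rhs_sgn => y_le y_ge.
suff conclude : ((k + 1 <= b 2 + c 3)%N -> (x + 1) * (y + 1) * (z + 1) <
    (t`_0 + 1) * (t`_(1 + (D - 4).+1) + 1) * (t`_(2 + (D - 4).+1) + 1)) /\
  ((b 2 + c 3 <= k + 1)%N -> (t`_0 + 1) * (t`_1 + 1) * (t`_(2 + (D - 4).+1) + 1) <
    (x + 1) * (y + 1) * (z + 1)).
  case: conclude => lt1 lt2; split=> [/lt1|/lt2] lt; split; rewrite ?ltW //.
    by split=> [eq_l|D3]; [move: lt; rewrite eq_l ltxx | rewrite D3 in D_neq3].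
  by split=> [eq_l|D3]; [move: lt; rewrite eq_l ltxx | rewrite D3 in D_neq3].
have X_gt : x + 1 < t`_0 + 1 by rewrite ltrD2r.
have Z_lt : - (z + 1) < - (t`_(2 + (D - 4).+1) + 1) by rewrite ltrN2 ltrD2r.
have z1_le0 : 0 <= - (z + 1) by rewrite oppr_ge0 ltW.
split=> [/y_le|/y_ge] y_sgn.
  (* The signs move onto the second and third factors, so that both sides are products of
     nonnegative factors, each strictly larger on the right. Strictness survives y + 1 = 0. *)
  rewrite -[ltLHS]mulrNN -[ltRHS]mulrNN.
  rewrite -[- (_ * (y + 1))]mulrN -[- (_ * (t`_ _ + 1))]mulrN.
  rewrite !ltr_pM ?mulr_ge0 ?oppr_ge0 ?ltrN2 ?ltrD2r //; exact: ltW.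
(* Here y + 1 is nonnegative, so only the last factor changes sign and the inequality is
   reversed. *)
rewrite -ltrN2 -!mulrN !ltr_pM ?mulr_ge0 ?ltrD2r //; exact: ltW.
Qed.
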